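(* Suppose that $\phi_i$ is $\tilde L$-smooth and convex for every $i\in[n]$. Let $\gamma=\lambda\tilde L$, and run adfSDCA (described in the context) where at every iteration $t\ge 0$ the probability vector is $$p_i^{(t)}=\frac{\sqrt{v_i\gamma+n\lambda^2}\,|\kappa_i^{(t)}|}{\sum_{j\in I_{\kappa^{(t)}}}\sqrt{v_j\gamma+n\lambda^2}\,|\kappa_j^{(t)}|},\qquad i\in[n],$$ and the step size is $$\theta^{(t)}=\frac{n\lambda^2\sum_{i\in I_{\kappa^{(t)}}}(\kappa_i^{(t)})^2}{\big(\sum_{i\in I_{\kappa^{(t)}}}\sqrt{v_i\gamma+n\lambda^2}\,|\kappa_i^{(t)}|\big)^2},$$ with $\theta^{(t)}\in(0,1)$. Then for all $t\ge 0$, $$\mathbf E[D^{(t+1)}\mid\alpha^{(t)}]\le(1-\theta^* )D^{(t)},\qquad\text{where}\quad \theta^*:=\frac{n\lambda^2}{\sum_{i=1}^n(v_i\gamma+n\lambda^2)}\le\theta^{(t)}.$$ Moreover, for $\epsilon>0$, if $$T\ge\Big(n+\frac{\tilde LQ}{\lambda}\Big)\log\Big(\frac{(\lambda+L)C_0}{2\lambda\tilde L\epsilon}\Big),$$ then $\mathbf E[P(w^{(T)})-P(w^* )]\le\epsilon$.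
   Context: Setting. $[n]=\{1,\dots,n\}$; $x_1,\dots,x_n\in\mathbb R^d$; $\lambda>0$; $\phi_1,\dots,\phi_n:\mathbb R\to\mathbb R$ are differentiable. $P(w)=\frac1n\sum_{i=1}^n\phi_i(w^Tx_i)+\frac\lambda2\|w\|^2$ for $w\in\mathbb R^d$. Each $\phi_i$ is $\tilde L_i$-smooth with $\tilde L_i>0$: $|\phi_i'(\beta)-\phi_i'(\beta+\delta)|\le\tilde L_i|\delta|$ for all $\beta,\delta\in\mathbb R$; $\tilde L=\max_i\tilde L_i$. The function $w\mapsto\phi_i(x_i^Tw)$ on $\mathbb R^d$ is $L_i$-smooth (its gradient is $L_i$-Lipschitz), where $L_i\le\|x_i\|^2\tilde L_i$; $L=\max_iL_i$. $v_i=\|x_i\|^2$ and $Q=\frac1n\sum_{i=1}^nv_i$. $w^*$ is the minimizer of $P$ and $\alpha^*\in\mathbb R^n$ is given by $\alpha_i^*=-\phi_i'(x_i^Tw^* )$. adfSDCA. Choose (deterministic) $\alpha^{(0)}\in\mathbb R^n$ and set $w^{(0)}=\frac1{\lambda n}\sum_{i}\alpha_i^{(0)}x_i$. At iteration $t=0,1,2,\dots$: compute the dual residue $\kappa_i^{(t)}=\alpha_i^{(t)}+\phi_i'(x_i^Tw^{(t)})$ for all $i\in[n]$; sample a coordinate $i\in[n]$ according to a probability vector $p^{(t)}$ (depending on the current iterate), and set $\alpha_i^{(t+1)}=\alpha_i^{(t)}-\theta^{(t)}(p_i^{(t)})^{-1}\kappa_i^{(t)}$, $\alpha_j^{(t+1)}=\alpha_j^{(t)}$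 for $j\ne i$, and $w^{(t+1)}=w^{(t)}-\theta^{(t)}(n\lambda p_i^{(t)})^{-1}\kappa_i^{(t)}x_i$. For $\kappa\in\mathbb R^n$, $I_\kappa=\{i\in[n]:\kappa_i\ne0\}$. (If $\kappa^{(t)}=0$ the formulas for $p^{(t)}$ and $\theta^{(t)}$ are undefined; then the iterates are kept unchanged, and the assertions involving $\theta^{(t)}$ are only for $\kappa^{(t)}\neq0$.) Potential. $D^{(t)}=\frac1n\|\alpha^{(t)}-\alpha^*\|^2+\gamma\|w^{(t)}-w^*\|^2$ and $C_0=D^{(0)}$. $\log$ is the natural logarithm (with $\log 0=-\infty$), $T$ is a nonnegative integer. *)

(* Defs.v *)
From mathcomp Require Import all_boot all_order all_algebra.
From mathcomp Require Import all_classical all_reals all_analysis.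

Set Implicit Arguments.
Unset Strict Implicit.
Unset Printing Implicit Defensive.

Import Order.TTheory GRing.Theory Num.Theory.
Import numFieldNormedType.Exports.

Local Open Scope classical_set_scope.
Local Open Scope ring_scope.

Definition dot (R : realType) (d : nat) (u v : 'cV[R]_d) : R := (u^T *m v) 0 0.

(* The library norm on matrices is the sup norm; this is the Euclidean one. *)
Definition enorm (R : realType) (d : nat) (u : 'cV[R]_d) : R :=
  Num.sqrt (dot u u).

(* Maximum of a nonempty finite family; F (Ordinal hn) is only a seed, so that
   no sign condition on F is needed. *)
Definition maxI (R : realType) (n : nat) (hn : (0 < n)%N) (F : 'I_n -> R) : R :=
  \big[Num.max/F (Ordinal hn)]_(i < n) F i.

Definition smooth1 (R : realType) (L : R) (f : R -> R) : Prop :=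
  forall b e : R, `|derive1 f b - derive1 f (b + e)| <= L * `|e|.

Definition gradient (R : realType) (d : nat) (f : 'cV[R]_d -> R)
    (w : 'cV[R]_d) : 'cV[R]_d :=
  \col_(j < d) 'D_(delta_mx j 0) f w.

Definition smooth (R : realType) (d : nat) (L : R) (f : 'cV[R]_d -> R) : Prop :=
  (forall w, differentiable f w) /\
  (forall w w', enorm (gradient f w - gradient f w') <= L * enorm (w - w')).

Definition primal (R : realType) (n d : nat) (lambda : R) (phi : 'I_n -> R -> R)
    (x : 'I_n -> 'cV[R]_d) (w : 'cV[R]_d) : R :=
  n%:R^-1 * (\sum_(i < n) phi i (dot w (x i))) + lambda / 2 * enorm w ^+ 2.

(* A state of the algorithm is the pair (alpha, w). *)

Definition init_state (R : realType) (n d : nat) (lambda : R)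
    (x : 'I_n -> 'cV[R]_d) (alpha0 : 'cV[R]_n) : 'cV[R]_n * 'cV[R]_d :=
  (alpha0, (lambda * n%:R)^-1 *: \sum_(i < n) alpha0 i 0 *: x i).

Definition residue (R : realType) (n d : nat) (phi : 'I_n -> R -> R)
    (x : 'I_n -> 'cV[R]_d) (st : 'cV[R]_n * 'cV[R]_d) : 'cV[R]_n :=
  \col_(i < n) (st.1 i 0 + derive1 (phi i) (dot (x i) st.2)).

Definition potential (R : realType) (n d : nat) (gamma : R)
    (alphastar : 'cV[R]_n) (wstar : 'cV[R]_d)
    (st : 'cV[R]_n * 'cV[R]_d) : R :=
  n%:R^-1 * enorm (st.1 - alphastar) ^+ 2 + gamma * enorm (st.2 - wstar) ^+ 2.

(* One iteration with sampled coordinate i, for arbitrary rules prob and step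
   giving the probability vector and the step size from the residue.  The state
   is frozen once the residue vanishes, where the rules may be meaningless. *)
Definition sdca_step (R : realType) (n d : nat) (lambda : R)
    (phi : 'I_n -> R -> R) (x : 'I_n -> 'cV[R]_d)
    (prob : 'cV[R]_n -> 'I_n -> R) (step : 'cV[R]_n -> R)
    (st : 'cV[R]_n * 'cV[R]_d) (i : 'I_n) : 'cV[R]_n * 'cV[R]_d :=
  let kappa := residue phi x st in
  if kappa == 0 then st else
  (st.1 - (step kappa * (prob kappa i)^-1 * kappa i 0) *: delta_mx i 0,
   st.2 - (step kappa * (n%:R * lambda * prob kappa i)^-1 * kappa i 0) *: x i).

(* State after t iterations when coordinate s r is sampled at iteration r. *)
Fixpoint sdca_run (R : realType) (n d : nat) (lambda : R)
    (phi : 'I_n -> R -> R) (x : 'I_n -> 'cV[R]_d)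
    (prob : 'cV[R]_n -> 'I_n -> R) (step : 'cV[R]_n -> R)
    (alpha0 : 'cV[R]_n) (s : nat -> 'I_n) (t : nat) : 'cV[R]_n * 'cV[R]_d :=
  if t is t'.+1
  then sdca_step lambda phi x prob step
         (sdca_run lambda phi x prob step alpha0 s t') (s t')
  else init_state lambda x alpha0.

(* The random coordinates I 0, I 1, ... are sampled as prescribed by prob:
   conditionally on I 0 = h 0, ..., I (t-1) = h (t-1), the coordinate I t has
   law prob at the current residue.  Nothing is prescribed at a null residue. *)
Definition sdca_sampling (R : realType) (n d : nat) (lambda : R)
    (phi : 'I_n -> R -> R) (x : 'I_n -> 'cV[R]_d)
    (prob : 'cV[R]_n -> 'I_n -> R) (step : 'cV[R]_n -> R)
    (alpha0 : 'cV[R]_n)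
    (disp : measure_display) (Omega : measurableType disp)
    (Pr : probability Omega R) (I : nat -> Omega -> 'I_n) : Prop :=
  (forall t i, measurable [set omega | I t omega = i]) /\
  (forall (t : nat) (h : nat -> 'I_n) (i : 'I_n),
     let kappa := residue phi x (sdca_run lambda phi x prob step alpha0 h t) in
     let past := [set omega | forall r, (r < t)%N -> I r omega = h r] in
     kappa != 0 ->
     Pr (past `&` [set omega | I t omega = i]) =
       (Pr past * (prob kappa i)%:E)%E).

(* E[X | Y] for Y with finitely many values: its value at omega is the mean of
   X over the event {Y = Y omega}.  It is 0 on the atoms of probability 0. *)
Definition cond_expectation (R : realType)
    (disp : measure_display) (Omega : measurableType disp)
    (Pr : probability Omega R) (U : Type) (X : Omega -> R) (Y : Omega -> U)
    (omega : Omega) : \bar R :=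
  let A := [set omega' | Y omega' = Y omega] in
  ('E_Pr[fun omega' => (X omega' * \1_A omega')%R] * ((fine (Pr A))^-1)%:E)%E.

Definition weight (R : realType) (n d : nat) (lambda gamma : R)
    (x : 'I_n -> 'cV[R]_d) (i : 'I_n) : R :=
  enorm (x i) ^+ 2 * gamma + n%:R * lambda ^+ 2.

Definition adf_prob (R : realType) (n d : nat) (lambda gamma : R)
    (x : 'I_n -> 'cV[R]_d) (kappa : 'cV[R]_n) (i : 'I_n) : R :=
  Num.sqrt (weight lambda gamma x i) * `|kappa i 0| /
  \sum_(j < n | kappa j 0 != 0)
    Num.sqrt (weight lambda gamma x j) * `|kappa j 0|.

Definition adf_step (R : realType) (n d : nat) (lambda gamma : R)
    (x : 'I_n -> 'cV[R]_d) (kappa : 'cV[R]_n) : R :=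
  n%:R * lambda ^+ 2 * (\sum_(i < n | kappa i 0 != 0) kappa i 0 ^+ 2) /
  (\sum_(i < n | kappa i 0 != 0)
     Num.sqrt (weight lambda gamma x i) * `|kappa i 0|) ^+ 2.

Definition adf_rate (R : realType) (n d : nat) (lambda gamma : R)
    (x : 'I_n -> 'cV[R]_d) : R :=
  n%:R * lambda ^+ 2 / \sum_(i < n) weight lambda gamma x i.

(* Main.v *)
(* Convexity and smoothness make each phi_i' cocoercive.  Combined with the
   stationarity lambda n w* = - sum_i phi_i'(x_i . w* ) x_i and the invariant
   lambda n w = sum_i alpha_i x_i, which gives n grad P(w) = sum_i kappa_i x_i,
   this bounds D + |kappa|^2 / n by the linear decrease term of one step.  The
   sampling probabilities minimise the quadratic term of the step, whose mean
   is then theta^2 (sum_i sqrt(W_i) |kappa_i|)^2 / (n lambda)^2 with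
   W_i = v_i gamma + n lambda^2, and the step size is the one for which it
   equals theta |kappa|^2 / n, so that E D' <= (1 - theta) D.  Cauchy-Schwarz
   gives theta >= theta*.  The bound on the primal gap follows from the
   (lambda + L)-smoothness of P at its stationary point w*. *)
Require Import Defs.
From mathcomp Require Import all_boot all_order all_algebra.
From mathcomp Require Import all_classical all_reals all_analysis.
From mathcomp Require Import ring lra.

Set Implicit Arguments.
Unset Strict Implicit.
Unset Printing Implicit Defensive.

Import Order.TTheory GRing.Theory Num.Theory.
Import numFieldNormedType.Exports.

Local Open Scope classical_set_scope.
Local Open Scope ring_scope.

(** * Euclidean inner product and norm on column vectors *)

Section euclidean.
Variables (R : realType) (d : nat).
Implicit Types (u v w : 'cV[R]_d) (a : R).

Lemma dotE u v : dot u v = \sum_i u i 0 * v i 0.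
Proof. by rewrite /dot mxE; apply: eq_bigr => i _; rewrite mxE. Qed.

Lemma dotC u v : dot u v = dot v u.
Proof. by rewrite !dotE; apply: eq_bigr => i _; rewrite mulrC. Qed.

Lemma dotDl u v w : dot (u + v) w = dot u w + dot v w.
Proof. by rewrite /dot linearD mulmxDl mxE. Qed.

Lemma dotZl a u v : dot (a *: u) v = a * dot u v.
Proof. by rewrite /dot linearZ /= -scalemxAl mxE. Qed.

Lemma dotDr u v w : dot u (v + w) = dot u v + dot u w.
Proof. by rewrite dotC dotDl !(dotC u). Qed.

Lemma dotZr a u v : dot u (a *: v) = a * dot u v.
Proof. by rewrite dotC dotZl dotC. Qed.

Lemma dotNl u v : dot (- u) v = - dot u v.
Proof. by rewrite -scaleN1r dotZl mulN1r. Qed.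

Lemma dotNr u v : dot u (- v) = - dot u v.
Proof. by rewrite dotC dotNl dotC. Qed.

Lemma dotBl u v w : dot (u - v) w = dot u w - dot v w.
Proof. by rewrite dotDl dotNl. Qed.

Lemma dotBr u v w : dot u (v - w) = dot u v - dot u w.
Proof. by rewrite dotDr dotNr. Qed.

Lemma dot0l v : dot 0 v = 0.
Proof. by rewrite -[0](scale0r v) dotZl mul0r. Qed.

Lemma dot_suml (J : finType) (F : J -> 'cV[R]_d) v :
  dot (\sum_j F j) v = \sum_j dot (F j) v.
Proof.
by elim/big_rec2: _ => [|j a u _ <-]; rewrite ?dot0l ?dotDl.
Qed.

Lemma dot_ge0 u : 0 <= dot u u.
Proof. by rewrite dotE sumr_ge0 // => i _; rewrite -expr2 sqr_ge0. Qed.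

Lemma dot_eq0 u : (dot u u == 0) = (u == 0).
Proof.
apply/eqP/eqP => [|->]; last by rewrite dot0l.
rewrite dotE => /eqP; rewrite psumr_eq0 => [/allP h|i _]; last first.
  by rewrite -expr2 sqr_ge0.
apply/colP => i; rewrite mxE; apply/eqP.
by have := h i (mem_index_enum _); rewrite /= -expr2 sqrf_eq0.
Qed.

Lemma enorm_sqr u : enorm u ^+ 2 = dot u u.
Proof. by rewrite sqr_sqrtr // dot_ge0. Qed.

Lemma enorm_ge0 u : 0 <= enorm u.
Proof. exact: sqrtr_ge0. Qed.

Lemma enormZ a u : enorm (a *: u) = `|a| * enorm u.
Proof.
by rewrite /enorm dotZl dotZr mulrA -expr2 sqrtrM ?sqr_ge0 // sqrtr_sqr.
Qed.

(** The squared norm of [dot v v *: u - dot u v *: v] is nonnegative and equals [dot v v] times the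
    difference of the two sides. *)
Lemma cauchy_schwarz u v : dot u v ^+ 2 <= dot u u * dot v v.
Proof.
have [/eqP|v0] := eqVneq (dot v v) 0.
  by rewrite dot_eq0 => /eqP ->; rewrite dotC !dot0l expr0n mulr0.
have v_gt0 : 0 < dot v v by rewrite lt_def v0 dot_ge0.
have := dot_ge0 (dot v v *: u - dot u v *: v).
rewrite !(dotBl, dotBr, dotZl, dotZr) (dotC v u) => h.
by rewrite -subr_ge0 -(pmulr_rge0 _ v_gt0); move: h; congr (0 <= _); ring.
Qed.

End euclidean.

(** * Quadratic upper model of a smooth function of one variable *)

Section one_dim.
Variables (R : realType) (M : R) (f : R -> R).
Hypothesis f_derivable : forall b : R, derivable f b 1.
Hypothesis f_smooth : smooth1 M f.

Lemma smooth1_ge0 : 0 <= M.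
Proof. by have := f_smooth 0 1; rewrite normr1 mulr1; apply: le_trans. Qed.

Lemma smooth1_dist x y : `|derive1 f y - derive1 f x| <= M * `|y - x|.
Proof. by have := f_smooth y (x - y); rewrite addrCA subrr addr0 [`|x - _|]distrC. Qed.

(* [f] minus its quadratic upper model at [x] has derivative of the sign of
   [x - y] at [y], hence is maximal at [x]. *)
Lemma descent x y : f y <= f x + derive1 f x * (y - x) + M / 2 * (y - x) ^+ 2.
Proof.
pose g z := f z - (derive1 f x * (z - x) + M / 2 * (z - x) ^+ 2).
suff : g y <= g x by rewrite /g subrr; lra.
have dg (z : R) : is_derive z (1 : R) g (derive1 f z - (derive1 f x + M * (z - x))).
  have fz : is_derive z (1 : R) f (derive1 f z).
    by rewrite derive1E; apply/derivableP.
  apply: is_derive_eq.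
  rewrite /GRing.scale /=. lra.
have cg a b : {within `[a, b], continuous g}.
  by apply: derivable_within_continuous => z _; case: (dg z).
have [xy|yx] := leP x y.
  have [c] := MVT_segment xy (fun z _ => dg z) (cg x y).
  rewrite in_itv /= => /andP[xc cy] e.
  rewrite -subr_le0 e mulr_le0_ge0 ?subr_ge0 //.
  have := smooth1_dist x c; rewrite [`|c - x|]ger0_norm ?subr_ge0 //.
  by have := ler_norm (derive1 f c - derive1 f x); lra.
have [c] := MVT_segment (ltW yx) (fun z _ => dg z) (cg y x).
rewrite in_itv /= => /andP[yc cx] e.
rewrite -subr_ge0 e mulr_ge0 ?subr_ge0 ?(ltW yx) //.
have := smooth1_dist x c; rewrite [`|c - x|]ler0_norm ?subr_le0 //.
have := ler_norm (derive1 f x - derive1 f c); rewrite (distrC (derive1 f x)).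
lra.
Qed.

End one_dim.

(** * Convexity in one variable: tangent lines and cocoercivity *)

Section one_dim_convex.
Variables (R : realType) (M : R) (f : R -> R).
Hypothesis f_derivable : forall b : R, derivable f b 1.
Hypothesis f_smooth : smooth1 M f.
Hypothesis f_convex : convex_function [set: R^o] f.

Lemma descent_lower x y :
  f x + derive1 f x * (y - x) - M / 2 * (y - x) ^+ 2 <= f y.
Proof.
have dN b : derive1 (- f) b = - derive1 f b.
  by rewrite !derive1E deriveN.
have dv b : derivable (- f) (b : R) 1 by exact: derivableN.
have sm : smooth1 M (- f).
  by move=> b e; rewrite !dN -opprD normrN; exact: f_smooth.
have := descent dv sm x y; rewrite dN.
by have eN z : (- f) z = - f z by []; rewrite !eN; lra.
Qed.

Lemma convex_tangent x y : f x + derive1 f x * (y - x) <= f y.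
Proof.
set c := M / 2 * (y - x) ^+ 2.
have c0 : 0 <= c by rewrite mulr_ge0 ?sqr_ge0 // divr_ge0 ?(smooth1_ge0 f_smooth).
(* The quadratic error vanishes relative to [t] as [t] goes to 0, so comparing
   with convexity along the segment needs no limit of difference quotients. *)
have key (t : R) : 0 < t -> t <= 1 -> f x + derive1 f x * (y - x) <= f y + t * c.
  move=> t0 t1.
  have h2 : f (t * y + (1 - t) * x) <= t * f y + (1 - t) * f x :=
    f_convex (Itv01 (ltW t0) t1) (mem_setT (y : R^o)) (mem_setT (x : R^o)).
  have h1 := descent_lower x (t * y + (1 - t) * x).
  rewrite -(ler_pM2l t0) /c.
  move: h2 (le_trans h1 h2); lra.
apply/ler_addgt0Pr => e e0.
have ec : 0 < e + c by rewrite ltr_wpDr.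
(* This [t] lies in (0, 1] and satisfies t c <= e. *)
apply: (le_trans (key (e / (e + c)) _ _)); first by rewrite divr_gt0.
  by rewrite ler_pdivrMr // mul1r lerDl.
by rewrite lerD2l mulrAC ler_pdivrMr // ler_pM2l // lerDr ltW.
Qed.

Lemma derive1_mono x y : 0 <= (derive1 f x - derive1 f y) * (x - y).
Proof. by have := convex_tangent x y; have := convex_tangent y x; lra. Qed.

(** As the derivative is nondecreasing, its increment times [x - y] is the product of their absolute
    values; the Lipschitz bound then trades [M * |x - y|] for a second factor [|f' x - f' y|]. *)
Lemma cocoercive x y :
  (derive1 f x - derive1 f y) ^+ 2 <= M * ((derive1 f x - derive1 f y) * (x - y)).
Proof.
rewrite -(ger0_norm (derive1_mono x y)) normrM mulrCA -real_normK ?num_real // expr2.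
by rewrite ler_wpM2l // smooth1_dist.
Qed.

End one_dim_convex.

(** * Ridge functions [w |-> f (dot x w)] *)

Section ridge.
Variables (R : realType) (d : nat) (x : 'cV[R]_d) (f : R -> R) (M : R).
Hypothesis f_derivable : forall b : R, derivable f b 1.
Hypothesis ridge_smooth : smooth M (fun w => f (dot x w)).

Lemma gradient_ridge (w : 'cV[R]_d) :
  gradient (fun w => f (dot x w)) w = derive1 f (dot x w) *: x.
Proof.
apply/colP => j; rewrite !mxE.
pose g (h : R) := f (h * x j 0 + dot x w).
have dg : is_derive (0 : R) (1 : R) g (derive1 f (dot x w) * x j 0).
  have fz : is_derive (0 * x j 0 + dot x w) (1 : R) f (derive1 f (dot x w)).
    by rewrite mul0r add0r derive1E; apply/derivableP.
  apply: is_derive_eq.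
  rewrite /GRing.scale /=; ring.
(* The difference quotients of [g] at 0 and of the ridge function along the j-th basis vector are
   the same function of [h]. *)
case: dg => _ <-; rewrite /derive; set F1 := (F in F @ _); set F2 := (F in _ = lim (F @ _)).
suff -> : F1 = F2 by [].
apply/funext => h; rewrite /F1 /F2 /=; congr (_ *: (f _ - f _)).
  rewrite dotDr dotZr addr0 dotE (bigD1 j) //= big1 ?addr0.
    by rewrite !mxE !eqxx mulr1 /GRing.scale /= mulr1.
  by move=> i ij; rewrite !mxE (negbTE ij) mulr0.
by rewrite mul0r add0r.
Qed.

(** The points [(b / dot x x) *: x] of the line spanned by [x] have inner product [b] with [x], so
    the Lipschitz bound on the gradient restricts to one on the derivative of [f]. *)
Lemma ridge_smooth1 : x != 0 -> smooth1 (M / dot x x) f.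
Proof.
rewrite -dot_eq0 => x0 b e.
have x_gt0 : 0 < enorm x by rewrite sqrtr_gt0 lt_def x0 dot_ge0.
have [_ /(_ ((b / dot x x) *: x) (((b + e) / dot x x) *: x))] := ridge_smooth.
rewrite !gradient_ridge !dotZr !divfK // -!(scalerBl _ _ x) !enormZ mulrA ler_pM2r //.
move=> /le_trans; apply.
by rewrite -mulrBl opprD addrA subrr add0r normrM normrN normfV (ger0_norm (dot_ge0 x)) mulrA mulrAC.
Qed.

(** The one-dimensional upper model with constant M / |x|^2, followed by Cauchy-Schwarz on
    [dot x (w' - w)]. Going through [f] gives the constant [M] of the ridge function itself. *)
Lemma ridge_descent (w w' : 'cV[R]_d) :
  f (dot x w') <= f (dot x w) + derive1 f (dot x w) * dot x (w' - w)
                  + M / 2 * dot (w' - w) (w' - w).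
Proof.
have [x0|x0] := eqVneq x 0.
  (* Here [M] may be negative if d = 0; the Lipschitz bound still gives 0 <= M |w' - w|, which is
     enough. *)
  rewrite x0 !dot0l mulr0 addr0 lerDl mulrAC divr_ge0 //.
  have [_ /(_ w' w)/(ler_wpM2r (enorm_ge0 (w' - w)))] := ridge_smooth.
  rewrite -mulrA -expr2 enorm_sqr; apply: le_trans.
  by rewrite mulr_ge0 ?enorm_ge0.
have sm := ridge_smooth1 x0.
apply: (le_trans (descent f_derivable sm (dot x w) (dot x w'))).
rewrite -dotBr lerD2l.
have x_gt0 : 0 < dot x x by rewrite lt_def dot_eq0 x0 dot_ge0.
have -> : M / 2 * dot (w' - w) (w' - w) =
    M / dot x x / 2 * (dot x x * dot (w' - w) (w' - w)).
  by field; rewrite gt_eqF.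
rewrite ler_wpM2l ?cauchy_schwarz // divr_ge0 //.
exact: smooth1_ge0 sm.
Qed.

End ridge.

(** * The primal objective, its stationary point and the primal-dual link *)

Section primal.
Variables (R : realType) (n d : nat) (lambda : R) (phi : 'I_n -> R -> R)
  (x : 'I_n -> 'cV[R]_d).
Hypothesis n_gt0 : (0 < n)%N.
Hypothesis phi_derivable : forall i (b : R), derivable (phi i) b 1.

(** The gradient of [primal] as an explicit formula; [primal_descent] is what ties it to
    [primal]. *)
Definition primal_grad (w : 'cV[R]_d) : 'cV[R]_d :=
  lambda *: w + n%:R^-1 *: \sum_i derive1 (phi i) (dot (x i) w) *: x i.

Let nR_gt0 : 0 < n%:R :> R.
Proof. by rewrite ltr0n. Qed.

Lemma primal_descent (L : R) (Li : 'I_n -> R) w w' :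
    (forall i, smooth (Li i) (fun w => phi i (dot (x i) w))) ->
    (forall i, Li i <= L) ->
  primal lambda phi x w' <= primal lambda phi x w
    + dot (primal_grad w) (w' - w) + (lambda + L) / 2 * dot (w' - w) (w' - w).
Proof.
move=> Li_smooth LiL; rewrite /primal !enorm_sqr.
set q := dot (w' - w) (w' - w).
have h : \sum_i phi i (dot w' (x i)) <= \sum_i phi i (dot w (x i)) +
    dot (\sum_i derive1 (phi i) (dot (x i) w) *: x i) (w' - w) + n%:R * (L / 2 * q).
  rewrite dot_suml -big_split /= mulr_natl -[X in _ *+ X]card_ord -sumr_const.
  rewrite -big_split /=; apply: ler_sum => i _.
  rewrite dotZl (dotC w') (dotC w).
  apply: (le_trans (ridge_descent (@phi_derivable i) (Li_smooth i) w w')).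
  by rewrite lerD2l ler_wpM2r ?dot_ge0 // ler_pM2r.
have ninv : 0 < n%:R^-1 :> R by rewrite invr_gt0.
have := h; rewrite -(ler_pM2l ninv) 2!mulrDr mulKf ?gt_eqF //.
rewrite /primal_grad dotDl !dotZl.
set a := dot (\sum_i _) _.
have -> : dot w' w' = dot w w + 2 * dot w (w' - w) + q.
  by rewrite /q !(dotBl, dotBr) (dotC w w'); ring.
lra.
Qed.

(* Otherwise a short step along the negative gradient would decrease [primal]. *)
Lemma primal_stationary (L : R) (Li : 'I_n -> R) wstar :
    (forall i, smooth (Li i) (fun w => phi i (dot (x i) w))) ->
    (forall i, Li i <= L) ->
    (forall w, primal lambda phi x wstar <= primal lambda phi x w) ->
  primal_grad wstar = 0.
Proof.
move=> Li_smooth LiL wmin; apply/eqP; rewrite -dot_eq0; apply/negPn/negP => g0.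
set g := primal_grad wstar in g0.
have g_gt0 : 0 < dot g g by rewrite lt_def g0 dot_ge0.
(* With this [t], (lambda + L) t / 2 < 1 whatever the sign of lambda + L, so the step strictly
   decreases the upper model. *)
set t := (`|lambda + L| + 1)^-1.
have t_gt0 : 0 < t by rewrite invr_gt0 ltr_wpDl.
have := le_trans (wmin (wstar - t *: g)) (primal_descent wstar _ Li_smooth LiL).
rewrite -/g [_ - _ - wstar]addrAC subrr add0r !(dotNl, dotNr, dotZl, dotZr) opprK => h.
have {h} : 0 <= (t * dot g g) * ((lambda + L) * t / 2 - 1).
  by rewrite -(lerD2l (primal lambda phi x wstar)) addr0; apply: (le_trans h); lra.
rewrite pmulr_rge0 ?mulr_gt0 // subr_ge0 ler_pdivlMr // mul1r /t.
rewrite ler_pdivlMr ?ltr_wpDl //.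
by have := ler_norm (lambda + L); have := normr_ge0 (lambda + L); lra.
Qed.

Variables (M : R) (wstar : 'cV[R]_d).
Hypothesis lambda_gt0 : 0 < lambda.
Hypothesis M_gt0 : 0 < M.
Hypothesis phi_smooth : forall i, smooth1 M (phi i).
Hypothesis phi_convex : forall i, convex_function [set: R^o] (phi i).
Hypothesis wstar_stat : primal_grad wstar = 0.

Let slope w i := derive1 (phi i) (dot (x i) w).
Let alphastar := \col_i - slope wstar i.
Let gamma := lambda * M.

(** Subtract [primal_grad wstar], which is 0: the regularizer contributes the first term exactly,
    and cocoercivity of each loss, between [dot (x i) w] and [dot (x i) wstar], contributes the
    second. *)
Lemma primal_grad_coercive w :
  gamma * dot (w - wstar) (w - wstar)
    + n%:R^-1 * (\sum_i (slope w i - slope wstar i) ^+ 2)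
  <= M * dot (primal_grad w) (w - wstar).
Proof.
rewrite -[primal_grad w]subr0 -wstar_stat /primal_grad opprD addrACA.
rewrite -!scalerBr [dot (_ *: _ + _) _]dotDl !dotZl mulrDr.
apply: lerD; first by rewrite mulrA (mulrC M).
rewrite mulrCA ler_pM2l ?invr_gt0 // -sumrB dot_suml mulr_sumr.
apply: ler_sum => i _; rewrite -scalerBl dotZl dotBr.
exact: cocoercive.
Qed.

(** The invariant of the algorithm. It makes [alpha] determine the whole state, so that conditioning
    on [alpha] amounts to conditioning on the state. *)
Definition primal_dual (st : 'cV[R]_n * 'cV[R]_d) :=
  st.2 = (lambda * n%:R)^-1 *: \sum_i st.1 i 0 *: x i.

Lemma primal_dual_inj st st' : primal_dual st -> primal_dual st' ->
  st.1 = st'.1 -> st = st'.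
Proof. by case: st st' => [a w] [a' w']; rewrite /primal_dual /= => -> -> ->. Qed.

Lemma primal_grad_residue st : primal_dual st ->
  primal_grad st.2 = n%:R^-1 *: \sum_i residue phi x st i 0 *: x i.
Proof.
move=> inv; rewrite /primal_grad {1}inv scalerA invfM mulrA divff ?gt_eqF //.
rewrite mul1r -scalerDr -big_split /=; congr (_ *: _); apply: eq_bigr => i _.
by rewrite -scalerDl mxE.
Qed.

(** The residue minus [st.1 - alphastar] is the vector of slope differences between [st.2] and
    [wstar]. Expanding its square in [primal_grad_coercive] brings out the dual distance, the
    squared residue and their cross term. *)
Lemma potential_residue st : primal_dual st ->
  potential gamma alphastar wstar st
    + n%:R^-1 * dot (residue phi x st) (residue phi x st)
  <= 2 * (n%:R^-1 * dot (residue phi x st) (st.1 - alphastar)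
          + M * dot (n%:R^-1 *: \sum_i residue phi x st i 0 *: x i) (st.2 - wstar)).
Proof.
move=> inv; rewrite -primal_grad_residue // /potential !enorm_sqr.
(* These two signs make the right side of [primal_grad_coercive] nonnegative, so that its
   coefficient may grow from 1 to 2. *)
have sq_ge0 : 0 <= n%:R^-1 * \sum_i (slope st.2 i - slope wstar i) ^+ 2.
  by rewrite mulr_ge0 ?invr_ge0 ?sumr_ge0 // => i _; rewrite sqr_ge0.
have w_ge0 : 0 <= gamma * dot (st.2 - wstar) (st.2 - wstar).
  by rewrite mulr_ge0 ?dot_ge0 // mulr_ge0 ?ltW.
have := primal_grad_coercive st.2; move: sq_ge0 w_ge0.
have -> : \sum_i (slope st.2 i - slope wstar i) ^+ 2 =
    dot (residue phi x st) (residue phi x st) + dot (st.1 - alphastar) (st.1 - alphastar)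
    - 2 * dot (residue phi x st) (st.1 - alphastar).
  rewrite !dotE mulr_sumr -big_split -sumrB /=; apply: eq_bigr => i _.
  by rewrite !mxE /slope; ring.
lra.
Qed.

End primal.

(** * The adaptive sampling probabilities and step size *)

Section adf_rules.
Variables (R : realType) (n d : nat) (lambda gamma : R) (x : 'I_n -> 'cV[R]_d).
Hypothesis n_gt0 : (0 < n)%N.
Hypothesis lambda_gt0 : 0 < lambda.
Hypothesis gamma_ge0 : 0 <= gamma.
Implicit Type kappa : 'cV[R]_n.

Let nl_gt0 : 0 < n%:R * lambda ^+ 2 :> R.
Proof. by rewrite mulr_gt0 ?ltr0n ?exprn_gt0. Qed.

Lemma weight_ge i : n%:R * lambda ^+ 2 <= weight lambda gamma x i.
Proof. by rewrite lerDr mulr_ge0 ?sqr_ge0. Qed.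

Lemma weight_gt0 i : 0 < weight lambda gamma x i.
Proof. exact: lt_le_trans (weight_ge i). Qed.

(** The denominator shared by [adf_prob] and [adf_step], extended to all coordinates: those off the
    support contribute 0. *)
Definition adf_norm kappa : R :=
  \sum_i Num.sqrt (weight lambda gamma x i) * `|kappa i 0|.

Lemma adf_normE kappa :
  \sum_(i | kappa i 0 != 0) Num.sqrt (weight lambda gamma x i) * `|kappa i 0|
  = adf_norm kappa.
Proof.
rewrite big_mkcond; apply: eq_bigr => i _.
by case: eqVneq => // ->; rewrite normr0 mulr0.
Qed.

Lemma support_sqr_sum kappa :
  \sum_(i | kappa i 0 != 0) kappa i 0 ^+ 2 = dot kappa kappa.
Proof.
rewrite dotE big_mkcond; apply: eq_bigr => i _.
by case: eqVneq => [->|]; rewrite ?mulr0.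
Qed.

Lemma adf_norm_gt0 kappa : kappa != 0 -> 0 < adf_norm kappa.
Proof.
move=> k0; have h i : 0 <= Num.sqrt (weight lambda gamma x i) * `|kappa i 0|.
  by rewrite mulr_ge0 ?sqrtr_ge0.
rewrite lt_def sumr_ge0 // andbT; apply: contra k0.
rewrite psumr_eq0 // => /allP z; apply/eqP/colP => i; rewrite mxE.
have := z i (mem_index_enum _).
by rewrite /= mulf_eq0 sqrtr_eq0 leNgt weight_gt0 /= normr_eq0 => /eqP.
Qed.

Lemma adf_probE kappa i : adf_prob lambda gamma x kappa i =
  Num.sqrt (weight lambda gamma x i) * `|kappa i 0| / adf_norm kappa.
Proof. by rewrite /adf_prob adf_normE. Qed.

Lemma adf_stepE kappa : adf_step lambda gamma x kappa =
  n%:R * lambda ^+ 2 * dot kappa kappa / adf_norm kappa ^+ 2.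
Proof. by rewrite /adf_step adf_normE support_sqr_sum. Qed.

Lemma adf_prob_sum kappa : kappa != 0 -> \sum_i adf_prob lambda gamma x kappa i = 1.
Proof.
move=> k0; under eq_bigr do rewrite adf_probE.
by rewrite -mulr_suml divff // gt_eqF // adf_norm_gt0.
Qed.

Lemma adf_prob_eq0 kappa i : kappa != 0 ->
  adf_prob lambda gamma x kappa i = 0 -> kappa i 0 = 0.
Proof.
move=> k0 /eqP; rewrite adf_probE !mulf_eq0 invr_eq0 (gt_eqF (adf_norm_gt0 k0)).
by rewrite orbF sqrtr_eq0 leNgt weight_gt0 /= normr_eq0 => /eqP.
Qed.

(** Dividing by the probability turns each nonzero term into [adf_norm kappa] times one summand of
    [adf_norm kappa]. *)
Lemma adf_prob_variance kappa : kappa != 0 ->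
  \sum_i weight lambda gamma x i * kappa i 0 ^+ 2 / adf_prob lambda gamma x kappa i
  = adf_norm kappa ^+ 2.
Proof.
move=> k0; rewrite expr2 {1}/adf_norm mulr_suml; apply: eq_bigr => i _.
have [ki|ki] := eqVneq (kappa i 0) 0.
  by rewrite ki normr0 expr0n /= !(mulr0, mul0r).
have w0 := weight_gt0 i; have S0 := adf_norm_gt0 k0.
rewrite adf_probE -{1}(sqr_sqrtr (ltW w0)) -[kappa i 0 ^+ 2]real_normK ?num_real //.
field; rewrite gt_eqF //= normr_eq0 ki /= gt_eqF // sqrtr_gt0 //.
Qed.

(** Cauchy-Schwarz for the vectors with entries sqrt(W_i) and |kappa_i|. *)
Lemma adf_norm_sqr_le kappa :
  adf_norm kappa ^+ 2 <= (\sum_i weight lambda gamma x i) * dot kappa kappa.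
Proof.
have := cauchy_schwarz (\col_i Num.sqrt (weight lambda gamma x i)) (\col_i `|kappa i 0|).
rewrite !dotE; congr (_ ^+ 2 <= _ * _); apply: eq_bigr => i _; rewrite !mxE //.
  by rewrite -expr2 sqr_sqrtr // ltW // weight_gt0.
by rewrite -expr2 real_normK ?num_real.
Qed.

Lemma weight_sum_ge : n%:R * lambda ^+ 2 <= \sum_i weight lambda gamma x i.
Proof.
rewrite (bigD1 (Ordinal n_gt0)) //= (le_trans (weight_ge (Ordinal n_gt0))) //.
by rewrite lerDl sumr_ge0 // => i _; rewrite ltW ?weight_gt0.
Qed.

Lemma adf_rate_ge0 : 0 <= adf_rate lambda gamma x.
Proof. by rewrite divr_ge0 ?(ltW nl_gt0) // (le_trans (ltW nl_gt0)) ?weight_sum_ge. Qed.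

Lemma adf_rate_le1 : adf_rate lambda gamma x <= 1.
Proof.
by rewrite ler_pdivrMr ?mul1r ?weight_sum_ge // (lt_le_trans nl_gt0) ?weight_sum_ge.
Qed.

Lemma adf_rate_le_step kappa : kappa != 0 ->
  adf_rate lambda gamma x <= adf_step lambda gamma x kappa.
Proof.
move=> k0; rewrite adf_stepE /adf_rate -[leRHS]mulrA ler_pM2l //.
have W0 := lt_le_trans nl_gt0 weight_sum_ge.
rewrite ler_pdivlMr ?exprn_gt0 ?adf_norm_gt0 // mulrC ler_pdivrMr //.
by rewrite mulrC adf_norm_sqr_le.
Qed.

End adf_rules.

(** * Change of the potential in one step, for arbitrary rules *)

Section one_step.
Variables (R : realType) (n d : nat) (lambda : R) (phi : 'I_n -> R -> R)
  (x : 'I_n -> 'cV[R]_d).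
Hypothesis n_gt0 : (0 < n)%N.
Hypothesis lambda_gt0 : 0 < lambda.
Variables (M : R) (alphastar : 'cV[R]_n) (wstar : 'cV[R]_d).
Let gamma := lambda * M.

Let nR_neq0 : n%:R != 0 :> R.
Proof. by rewrite pnatr_eq0 -lt0n. Qed.

(** Coordinate i of [alpha] moves by -c and [w] by -c / (n lambda) times [x i]. The choice gamma =
    lambda M gives both cross terms the factor 1/n, and the quadratic coefficient 1/n + gamma v_i /
    (n lambda)^2 is the weight over n^2 lambda^2. *)
Lemma potential_step prob step st i : residue phi x st != 0 ->
  let kappa := residue phi x st in
  let c := step kappa * (prob kappa i)^-1 * kappa i 0 in
  potential gamma alphastar wstar (sdca_step lambda phi x prob step st i) =
  potential gamma alphastar wstar st
  - 2 * c * (n%:R^-1 * ((st.1 i 0 - alphastar i 0) + M * dot (x i) (st.2 - wstar)))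
  + c ^+ 2 * weight lambda gamma x i / (n%:R * (n%:R * lambda ^+ 2)).
Proof.
move=> k0; rewrite /sdca_step (negbTE k0) /= /potential !enorm_sqr /=.
set k := residue phi x st; set c := _ * _ * k i 0.
have -> : step k * (n%:R * lambda * prob k i)^-1 * k i 0 = c / (n%:R * lambda).
  by rewrite /c invfM; ring.
rewrite /weight enorm_sqr ![_ - _ *: _ - _]addrAC.
rewrite !(dotBl, dotBr, dotZl, dotZr).
have eD (u : 'cV[R]_n) : dot u (delta_mx i 0) = u i 0.
  rewrite dotE (bigD1 i) //= big1 => [|j ji]; rewrite mxE ?eqxx ?mulr1 ?addr0 //.
  by rewrite (negbTE ji) mulr0.
rewrite !(dotC (delta_mx i 0)) !eD !mxE !eqxx /=.
rewrite !(dotC st.2) !(dotC wstar).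
rewrite /gamma; field.
by rewrite nR_neq0 gt_eqF.
Qed.

(** The factor 1 / p_i in the update cancels the sampling probability in the linear term, whose mean
    is thus independent of [prob]; only the quadratic term keeps a 1 / p_i. *)
Lemma mean_potential_step prob step st : residue phi x st != 0 ->
  let kappa := residue phi x st in
  \sum_i prob kappa i = 1 -> (forall i, prob kappa i = 0 -> kappa i 0 = 0) ->
  \sum_i prob kappa i *
    potential gamma alphastar wstar (sdca_step lambda phi x prob step st i) =
  potential gamma alphastar wstar st
  - 2 * step kappa * (n%:R^-1 * dot kappa (st.1 - alphastar)
      + M * dot (n%:R^-1 *: \sum_i kappa i 0 *: x i) (st.2 - wstar))
  + step kappa ^+ 2 * (\sum_i weight lambda gamma x i * kappa i 0 ^+ 2 / prob kappa i)
    / (n%:R * (n%:R * lambda ^+ 2)).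
Proof.
move=> k0 kappa p1 p0; set P := potential _ _ _ st; set q := n%:R * (_ * _).
pose a i := n%:R^-1 * ((st.1 i 0 - alphastar i 0) + M * dot (x i) (st.2 - wstar)).
transitivity (\sum_i (prob kappa i * P - 2 * step kappa * (kappa i 0 * a i)
    + step kappa ^+ 2 * (weight lambda gamma x i * kappa i 0 ^+ 2 / prob kappa i) / q)).
  apply: eq_bigr => i _; rewrite potential_step // -/kappa -/P -/(a i) -/q.
  (* A coordinate of probability 0 has null residue, so the term vanishes on both sides. *)
  have [pi0|pi0] := eqVneq (prob kappa i) 0.
    by rewrite pi0 (p0 _ pi0) invr0; ring.
  have q0 : q != 0 by rewrite gt_eqF // !mulr_gt0 ?ltr0n ?exprn_gt0.
  by field; rewrite pi0 q0.
rewrite big_split sumrB /= -!mulr_suml p1 mul1r -!mulr_sumr; congr (_ - _ * _ + _).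
rewrite dotZl dot_suml mulrCA -mulrDr dotE !mulr_sumr -big_split mulr_sumr /=.
by apply: eq_bigr => i _; rewrite !mxE dotZl /a; ring.
Qed.

Lemma primal_dual_step prob step st i :
  primal_dual lambda x st ->
  primal_dual lambda x (sdca_step lambda phi x prob step st i).
Proof.
rewrite /primal_dual /sdca_step; case: ifP => // _ inv /=.
set k := residue phi x st; set c := step k / prob k i * k i 0.
have -> : step k * (n%:R * lambda * prob k i)^-1 * k i 0 = (lambda * n%:R)^-1 * c.
  by rewrite /c !invfM; ring.
rewrite inv -scalerA -scalerBr; congr (_ *: _).
rewrite [RHS](eq_bigr (fun j => st.1 j 0 *: x j - (c * (j == i)%:R) *: x j)).
  rewrite sumrB; congr (_ - _); rewrite (bigD1 i) //= big1 ?addr0 ?eqxx ?mulr1 //.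
  by move=> j /negbTE ->; rewrite mulr0 scale0r.
by move=> j _; rewrite !mxE eqxx andbT scalerBl.
Qed.

End one_step.

(** * Contraction of the potential in one adaptive step *)

Section contraction.
Variables (R : realType) (n d : nat) (lambda : R) (phi : 'I_n -> R -> R)
  (x : 'I_n -> 'cV[R]_d) (M : R) (wstar : 'cV[R]_d).
Hypothesis n_gt0 : (0 < n)%N.
Hypothesis lambda_gt0 : 0 < lambda.
Hypothesis M_gt0 : 0 < M.
Hypothesis phi_derivable : forall i (b : R), derivable (phi i) b 1.
Hypothesis phi_smooth : forall i, smooth1 M (phi i).
Hypothesis phi_convex : forall i, convex_function [set: R^o] (phi i).
Hypothesis wstar_stat : primal_grad lambda phi x wstar = 0.

Let alphastar := \col_i - derive1 (phi i) (dot (x i) wstar).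
Let gamma := lambda * M.
Let D := potential gamma alphastar wstar.
Let rate := adf_rate lambda gamma x.

Let gamma_ge0 : 0 <= gamma.
Proof. by rewrite mulr_ge0 ?ltW. Qed.

Lemma potential_ge0 st : 0 <= D st.
Proof. by apply: addr_ge0; apply: mulr_ge0; rewrite ?sqr_ge0 ?invr_ge0. Qed.

(** Where the algorithm freezes, the right side of [potential_residue] is 0; the contraction is
    therefore trivial there. *)
Lemma potential_residue0 st : primal_dual lambda x st ->
  residue phi x st = 0 -> D st = 0.
Proof.
move=> inv k0; apply/eqP; rewrite eq_le potential_ge0 andbT.
have := potential_residue n_gt0 phi_derivable lambda_gt0 M_gt0 phi_smooth
  phi_convex wstar_stat inv.
rewrite k0 !dot0l big1 => [|i _]; last by rewrite mxE scale0r.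
by rewrite scaler0 dot0l !mulr0 !addr0 mulr0.
Qed.

Lemma adf_contraction st : primal_dual lambda x st -> residue phi x st != 0 ->
  \sum_i adf_prob lambda gamma x (residue phi x st) i *
    D (sdca_step lambda phi x (adf_prob lambda gamma x) (adf_step lambda gamma x) st i)
  <= (1 - rate) * D st.
Proof.
move=> inv k0; rewrite mean_potential_step //; last 2 first.
- exact: adf_prob_sum.
- by move=> i; apply: adf_prob_eq0.
have := potential_residue n_gt0 phi_derivable lambda_gt0 M_gt0 phi_smooth
  phi_convex wstar_stat inv.
rewrite adf_prob_variance // -/alphastar -/gamma -/D.
have th := adf_rate_le_step x n_gt0 lambda_gt0 gamma_ge0 k0.
set k := residue phi x st in k0 th *; set a := _ + M * _; set th_ := adf_step _ _ _ _ in th *.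
have -> : th_ ^+ 2 * adf_norm lambda gamma x k ^+ 2 / (n%:R * (n%:R * lambda ^+ 2))
  = th_ * (n%:R^-1 * dot k k).
  have S0 := adf_norm_gt0 x n_gt0 lambda_gt0 gamma_ge0 k0.
  rewrite [in LHS]expr2 {2}/th_ adf_stepE.
  by field; rewrite !gt_eqF ?ltr0n.
have th0 : 0 <= th_ by apply: le_trans th; exact: adf_rate_ge0.
(* Scaled by the step size, [potential_residue] leaves the factor 1 - theta, which is at most 1 -
   rate on a nonnegative potential. *)
move=> /(ler_wpM2l th0) h.
have := ler_wpM2r (potential_ge0 st) th; rewrite -/rate; lra.
Qed.

End contraction.

(** * Expectation of a finitely valued variable *)

Section finite_expectation.
Local Open Scope ereal_scope.

(** [F (Y omega)] is a finite combination of indicators of the fibres of [Y], integrated term by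
    term. *)
Lemma expectation_finite (R : realType) (disp : measure_display)
    (Omega : measurableType disp) (Pr : probability Omega R)
    (T : finType) (Y : Omega -> T) (F : T -> R) :
    (forall y, measurable [set omega | Y omega = y]) ->
  'E_Pr[fun omega => F (Y omega)] =
    (\sum_y F y * fine (Pr [set omega | Y omega = y]))%:E.
Proof.
move=> mY; rewrite unlock.
transitivity (\int[Pr]_omega (\sum_y (F y)%:E * (\1_[set o | Y o = y] omega)%:E)).
  apply: eq_integral => omega _; rewrite (bigD1 (Y omega)) //= big1 ?adde0.
    by rewrite indicE mem_set // mule1.
  move=> y /eqP yY; rewrite indicE memNset ?mule0 //=; exact/nesym.
have mint y : Pr.-integrable setT (fun o => (\1_[set o | Y o = y] o)%:E).
  exact: integrable_indic.
rewrite integral_sum // => [|y]; last exact: integrableZl.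
rewrite -sumEFin; apply: eq_bigr => y _.
by rewrite integralZl // integral_indic // setIT EFinM fineK // fin_num_measure.
Qed.

End finite_expectation.

(** * Finite histories of sampled coordinates *)

Section history.
Variables (n : nat) (n_gt0 : (0 < n)%N).

(* The value beyond time [t] is irrelevant: see [sdca_run_eq]. *)
Definition extend t (h : {ffun 'I_t -> 'I_n}) (r : nat) : 'I_n :=
  if insub r is Some k then h k else Ordinal n_gt0.

Definition history (Omega : Type) (I : nat -> Omega -> 'I_n) t omega :
  {ffun 'I_t -> 'I_n} := [ffun r : 'I_t => I r omega].

Lemma extend_history (Omega : Type) (I : nat -> Omega -> 'I_n) t omega r :
  (r < t)%N -> extend (history I t omega) r = I r omega.
Proof. by move=> rt; rewrite /extend insubT ffunE. Qed.

(** Identifies the fibres of [history], which ranges over a finite type, with the past events of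
    [sdca_sampling]. *)
Lemma historyP (Omega : Type) (I : nat -> Omega -> 'I_n) t
    (h : {ffun 'I_t -> 'I_n}) :
  [set omega | history I t omega = h] =
  [set omega | forall r, (r < t)%N -> I r omega = extend h r].
Proof.
apply/seteqP; split => omega /= hh.
  by move=> r rt; rewrite -hh extend_history.
by apply/ffunP => r; rewrite ffunE hh // /extend valK.
Qed.

Lemma sdca_run_eq (R : realType) (d : nat) (lambda : R) (phi : 'I_n -> R -> R)
    (x : 'I_n -> 'cV[R]_d) prob step alpha0 (s s' : nat -> 'I_n) t :
  (forall r, (r < t)%N -> s r = s' r) ->
  sdca_run lambda phi x prob step alpha0 s t =
  sdca_run lambda phi x prob step alpha0 s' t.
Proof.
elim: t => [//|t IH] ss /=.
by rewrite (IH (fun r rt => ss r (ltnW rt))) (ss t (ltnSn t)).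
Qed.

Lemma measurable_past (disp : measure_display) (Omega : measurableType disp)
    (I : nat -> Omega -> 'I_n) (s : nat -> 'I_n) t :
  (forall t i, measurable [set omega | I t omega = i]) ->
  measurable [set omega | forall r, (r < t)%N -> I r omega = s r].
Proof.
move=> mI; elim: t => [|t IH].
  by rewrite [X in measurable X](_ : _ = setT) //; apply/seteqP; split.
rewrite [X in measurable X](_ : _ =
    [set omega | forall r, (r < t)%N -> I r omega = s r] `&`
    [set omega | I t omega = s t]); first exact: measurableI.
apply/seteqP; split => omega /= => [h|[h ht] r].
  by split=> [r rt|]; apply: h => //; exact: ltnW.
by rewrite ltnS leq_eqVlt => /orP[/eqP -> //|]; exact: h.
Qed.

Lemma primal_dual_run (R : realType) (d : nat) (lambda : R)
    (phi : 'I_n -> R -> R) (x : 'I_n -> 'cV[R]_d) prob step alpha0 s t :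
  primal_dual lambda x (sdca_run lambda phi x prob step alpha0 s t).
Proof. by elim: t => //= t IH; exact: primal_dual_step. Qed.

End history.

(** * Expected behaviour of the randomly sampled run *)

Section sampled_run.
Variables (R : realType) (n d : nat) (lambda : R) (phi : 'I_n -> R -> R)
  (x : 'I_n -> 'cV[R]_d) (M : R) (wstar : 'cV[R]_d) (alpha0 : 'cV[R]_n).
Hypothesis n_gt0 : (0 < n)%N.
Hypothesis lambda_gt0 : 0 < lambda.
Hypothesis M_gt0 : 0 < M.
Hypothesis phi_derivable : forall i (b : R), derivable (phi i) b 1.
Hypothesis phi_smooth : forall i, smooth1 M (phi i).
Hypothesis phi_convex : forall i, convex_function [set: R^o] (phi i).
Hypothesis wstar_stat : primal_grad lambda phi x wstar = 0.

Let alphastar := \col_i - derive1 (phi i) (dot (x i) wstar).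
Let gamma := lambda * M.
Let D := potential gamma alphastar wstar.
Let rate := adf_rate lambda gamma x.
Let prob := adf_prob lambda gamma x.
Let step := adf_step lambda gamma x.
Let run := sdca_run lambda phi x prob step alpha0.

Let gamma_ge0 : 0 <= gamma.
Proof. by rewrite mulr_ge0 ?ltW. Qed.

Variables (disp : measure_display) (Omega : measurableType disp)
  (Pr : probability Omega R) (I : nat -> Omega -> 'I_n).
Hypothesis sampling : sdca_sampling lambda phi x prob step alpha0 Pr I.

Let mI : forall t i, measurable [set omega | I t omega = i].
Proof. by case: sampling. Qed.

Let state t omega := run (fun r => I r omega) t.

Lemma state_history t omega :
  state t omega = run (extend n_gt0 (history I t omega)) t.
Proof. by apply: sdca_run_eq => r rt; rewrite extend_history. Qed.

Lemma measurable_history t (h : {ffun 'I_t -> 'I_n}) :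
  measurable [set omega | history I t omega = h].
Proof. by rewrite (historyP n_gt0); exact: measurable_past. Qed.

(** The finitely valued variable that determines the state at time t+1, as [history] determines the
    one at time t. *)
Let next t omega := (history I t omega, I t omega).

Let nextE t (h : {ffun 'I_t -> 'I_n}) i : [set omega | next t omega = (h, i)] =
  [set omega | history I t omega = h] `&` [set omega | I t omega = i].
Proof. by apply/seteqP; split => omega /= [<- <-]. Qed.

Let measurable_next t hi : measurable [set omega | next t omega = hi].
Proof.
by case: hi => h i; rewrite nextE; apply: measurableI => //; exact: measurable_history.
Qed.

Lemma sampling_next t (h : {ffun 'I_t -> 'I_n}) i :
  let kappa := residue phi x (run (extend n_gt0 h) t) in kappa != 0 ->
  fine (Pr [set omega | next t omega = (h, i)]) =
  fine (Pr [set omega | history I t omega = h]) * prob kappa i.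
Proof.
move=> kappa k0; rewrite nextE (historyP n_gt0).
have [_ ->] := sampling; last exact: k0.
by rewrite fineM // fin_num_measure //; exact: measurable_past.
Qed.

(* With [B] full this is the contraction in mean; with [B] the histories leading
   to a given [alpha], the one conditional on [alpha]. *)
Lemma expected_decrease t (B : pred {ffun 'I_t -> 'I_n}) :
  ('E_Pr[fun omega => (D (state t.+1 omega) * (B (history I t omega))%:R)%R] <=
   (1 - rate)%:E * 'E_Pr[fun omega => (D (state t omega) * (B (history I t omega))%:R)%R])%E.
Proof.
pose st (h : {ffun 'I_t -> 'I_n}) := run (extend n_gt0 h) t.
pose F (hi : {ffun 'I_t -> 'I_n} * 'I_n) :=
  D (sdca_step lambda phi x prob step (st hi.1) hi.2) * (B hi.1)%:R.
pose G h := D (st h) * (B h)%:R.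
rewrite [X in ('E_Pr[X] <= _)%E](_ : _ = fun o => F (next t o)); last first.
  apply/funext => omega; by rewrite /F /= /st -state_history.
rewrite [X in (_ * 'E_Pr[X])%E](_ : _ = fun o => G (history I t o)); last first.
  by apply/funext => omega; rewrite /G /st -state_history.
rewrite (expectation_finite Pr F (@measurable_next t)).
rewrite (expectation_finite Pr G (@measurable_history t)).
rewrite -EFinM lee_fin mulr_sumr.
rewrite [leLHS](eq_bigr (fun hi => F (hi.1, hi.2) *
   fine (Pr [set omega | next t omega = (hi.1, hi.2)]))); last by case.
rewrite -(pair_bigA _ (fun h i => F (h, i) *
   fine (Pr [set omega | next t omega = (h, i)]))) /=.
apply: ler_sum => h _; rewrite /F /G /=.
(* At a null residue [sdca_sampling] says nothing about the next coordinate, but the state is frozen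
   with potential 0. *)
have [k0|k0] := eqVneq (residue phi x (st h)) 0.
  have D0 : D (st h) = 0 := potential_residue0 n_gt0 lambda_gt0 M_gt0 phi_derivable phi_smooth
    phi_convex wstar_stat (primal_dual_run _ _ _ _ _ _ _ _) k0.
  rewrite D0 !(mul0r, mulr0) big1 // => i _.
  by rewrite /sdca_step k0 eqxx D0 !mul0r.
have : \sum_i prob (residue phi x (st h)) i *
    D (sdca_step lambda phi x prob step (st h) i) <= (1 - rate) * D (st h)
  := adf_contraction n_gt0 lambda_gt0 M_gt0 phi_derivable phi_smooth
    phi_convex wstar_stat (primal_dual_run _ _ _ _ _ _ _ _) k0.
set q := fine (Pr [set omega | history I t omega = h]).
have q0 : 0 <= (B h)%:R * q by rewrite mulr_ge0 ?ler0n // fine_ge0.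
move=> /(ler_wpM2r q0); rewrite -!mulrA; apply: le_trans.
rewrite mulr_suml le_eqVlt; apply/orP; left; apply/eqP; apply: eq_bigr => i _.
by rewrite sampling_next // -/q; ring.
Qed.

Lemma expected_potential t :
  ('E_Pr[fun omega => D (state t omega)] <=
   ((1 - rate) ^+ t * D (init_state lambda x alpha0))%:E)%E.
Proof.
have r1 : 0 <= 1 - rate by rewrite subr_ge0; exact: adf_rate_le1.
elim: t => [|t IH]; first by rewrite expr0 mul1r -[leRHS](expectation_cst Pr).
have e s : (fun omega => D (state s omega)) =
    (fun omega => D (state s omega) * (predT (history I t omega))%:R).
  by apply/funext => omega; rewrite mulr1.
rewrite exprS -mulrA EFinM e (le_trans (expected_decrease predT)) // -e.
by rewrite lee_wpmul2l ?lee_fin.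
Qed.

(** The atom of [alpha] is a finite union of history events, to which [expected_decrease] applies.
    On it the potential at time t is constant, since [alpha] determines the state. *)
Lemma cond_expected_potential t omega :
  (cond_expectation Pr (fun omega => D (state t.+1 omega))
     (fun omega => (state t omega).1) omega <=
   ((1 - rate) * D (state t omega))%:E)%E.
Proof.
rewrite /cond_expectation.
set A := [set _ | _].
pose B (h : {ffun 'I_t -> 'I_n}) := (run (extend n_gt0 h) t).1 == (state t omega).1.
have r1 : 0 <= 1 - rate by rewrite subr_ge0; exact: adf_rate_le1.
have AE : \1_A = (fun omega => (B (history I t omega))%:R) :> (Omega -> R).
  apply/funext => o; rewrite indicE (_ : (o \in A) = B (history I t o)) //.
  by rewrite /B -state_history; apply/idP/eqP; rewrite inE.
have mA : measurable A.
  rewrite [A](_ : _ = \bigcup_(h in [set h | B h]) [set o | history I t o = h]).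
    exact: (fin_bigcup_measurable finite_finset (fun h _ => measurable_history h)).
  apply/seteqP; split=> [u uA|u [h /eqP Bh /= uh]].
    by exists (history I t u) => //=; rewrite /B -state_history uA.
  by rewrite /A /= -Bh state_history uh.
have DA : (fun o => D (state t o) * (B (history I t o))%:R) =
    (fun o => D (state t omega) * (B (history I t o))%:R).
  apply/funext => o; rewrite /B -state_history.
  case: eqP => [e|]; rewrite ?mulr0 //; congr (D _ * _).
  exact: primal_dual_inj (primal_dual_run _ _ _ _ _ _ _ _) (primal_dual_run _ _ _ _ _ _ _ _) e.
have PA : fine (Pr A) =
    \sum_h (B h)%:R * fine (Pr [set o | history I t o = h]).
  rewrite -(expectation_indic Pr mA) AE.
  by rewrite (expectation_finite Pr (fun h => (B h)%:R) (@measurable_history t)).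
have := expected_decrease B; rewrite DA AE.
rewrite (expectation_finite Pr (fun h => D (state t omega) * (B h)%:R) (@measurable_history t)).
rewrite (eq_bigr _ (fun h _ => esym (mulrA _ _ _))) -mulr_sumr -PA -EFinM.
(* On a null atom the conditional expectation is 0 by convention, and the right side is
   nonnegative. *)
have [->|PA0] := eqVneq (fine (Pr A)) 0.
  by rewrite invr0 mule0 lee_fin mulr_ge0 // potential_ge0.
by rewrite lee_pdivrMr ?lt_def ?PA0 ?fine_ge0 // -EFinM mulrA.
Qed.

(** The squared distance of [w] to [wstar] is at most D / gamma. [L] is any common bound on the
    [Li], which leaves room to change it when their maximum is below -lambda. *)
Lemma expected_suboptimality (L : R) (Li : 'I_n -> R) t :
    (forall i, smooth (Li i) (fun w => phi i (dot (x i) w))) ->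
    (forall i, Li i <= L) -> 0 <= lambda + L ->
  ('E_Pr[fun omega => (primal lambda phi x (state t omega).2 - primal lambda phi x wstar)%R]
   <= ((lambda + L) / (2 * gamma) *
       ((1 - rate) ^+ t * D (init_state lambda x alpha0)))%:E)%E.
Proof.
move=> Li_smooth LiL lL; have g0 : 0 < gamma by rewrite mulr_gt0.
have c0 : 0 <= (lambda + L) / (2 * gamma) by rewrite divr_ge0 // mulr_ge0.
pose st (h : {ffun 'I_t -> 'I_n}) := run (extend n_gt0 h) t.
pose F h := primal lambda phi x (st h).2 - primal lambda phi x wstar.
have := expected_potential t.
rewrite [X in ('E_Pr[X] <= _)%E -> _](_ : _ = fun o => (D \o st) (history I t o)); last first.
  by apply/funext => omega; rewrite /= /st -state_history.
rewrite [X in _ -> ('E_Pr[X] <= _)%E](_ : _ = fun o => F (history I t o)); last first.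
  by apply/funext => omega; rewrite /F /st -state_history.
rewrite !(expectation_finite _ _ (@measurable_history t)) !lee_fin.
move=> /(ler_wpM2l c0); apply: le_trans; rewrite mulr_sumr; apply: ler_sum => h _.
rewrite mulrA ler_wpM2r ?fine_ge0 // /F lerBlDl.
apply: (le_trans (primal_descent lambda n_gt0 phi_derivable wstar (st h).2 Li_smooth LiL)).
rewrite wstar_stat dot0l addr0 lerD2l.
have -> : (lambda + L) / 2 * dot ((st h).2 - wstar) ((st h).2 - wstar) =
    (lambda + L) / (2 * gamma) * (gamma * dot ((st h).2 - wstar) ((st h).2 - wstar)).
  by field; rewrite gt_eqF.
rewrite ler_wpM2l // /D /= /potential !enorm_sqr lerDr.
by rewrite mulr_ge0 ?invr_ge0 ?dot_ge0.
Qed.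

End sampled_run.

(** * From the contraction rate to the iteration count *)

Lemma one_sub_expn_le (R : realType) (r z : R) (T : nat) : 0 < r <= 1 ->
  ((r^-1)%:E * lne z%:E <= T%:R%:E)%E -> (1 - r) ^+ T * z <= 1.
Proof.
move=> /andP[r0 r1]; have p0 : 0 <= (1 - r) ^+ T by rewrite exprn_ge0 ?subr_ge0.
(* For z <= 0 the logarithm is -oo and the hypothesis is void, but then the product is
   nonpositive. *)
rewrite /=; case: ifPn => [z0 _|]; first exact: le_trans (mulr_ge0_le0 p0 z0) ler01.
rewrite -ltNge => z0; rewrite -EFinM lee_fin ler_pdivrMl // => h.
(* From 1 - r <= exp(-r), the power is at most exp(-rT), while the hypothesis says z <= exp(rT). *)
have pe : (1 - r) ^+ T <= expR (- (r * T%:R)).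
  by rewrite -mulNr [_ * T%:R]mulrC expRM_natl lerXn2r ?nnegrE ?subr_ge0 ?expR_ge0 ?expR_ge1Dx.
have ze : z <= expR (r * T%:R) by rewrite -[leLHS](lnK z0) ler_expR.
by rewrite (le_trans (ler_pM p0 (ltW z0) pe ze)) // -expRD addNr expR0.
Qed.

Lemma adf_rateE (R : realType) (n d : nat) (lambda M : R) (x : 'I_n -> 'cV[R]_d) :
    (0 < n)%N -> 0 < lambda -> 0 <= M ->
  adf_rate lambda (lambda * M) x =
  (n%:R + M * (n%:R^-1 * \sum_i enorm (x i) ^+ 2) / lambda)^-1.
Proof.
move=> n_gt0 l0 M0; rewrite /adf_rate /weight big_split /= -mulr_suml sumr_const card_ord.
rewrite -mulr_natl; set S := \sum_i _.
have S0 : 0 <= S by rewrite sumr_ge0 // => i _; rewrite sqr_ge0.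
have nR : 0 < n%:R :> R by rewrite ltr0n.
have Wgt0 : 0 < S * (lambda * M) + n%:R * lambda ^+ 2 * n%:R.
  by rewrite ltr_wpDl ?mulr_ge0 ?(ltW l0) // !mulr_gt0 ?exprn_gt0.
have Qgt0 : 0 < n%:R * (n%:R * lambda) + M * S.
  by rewrite ltr_pwDl ?mulr_ge0 // !mulr_gt0.
by field; rewrite !gt_eqF.
Qed.

Lemma maxI_ge (R : realType) (n : nat) (hn : (0 < n)%N) (F : 'I_n -> R) i :
  F i <= maxI hn F.
Proof. exact: le_bigmax. Qed.

Theorem theorem1 (R : realType) (n d : nat) (hn : (0 < n)%N)
    (x : 'I_n -> 'cV[R]_d) (lambda : R) (hlambda : 0 < lambda)
    (phi : 'I_n -> R -> R)
    (phi_derivable : forall i b, derivable (phi i) b 1)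
    (Lt : 'I_n -> R) (Lt_gt0 : forall i, 0 < Lt i)
    (phi_smooth : forall i, smooth1 (Lt i) (phi i))
    (Li : 'I_n -> R)
    (Li_smooth : forall i, smooth (Li i) (fun w => phi i (dot (x i) w)))
    (Li_le : forall i, Li i <= enorm (x i) ^+ 2 * Lt i)
    (wstar : 'cV[R]_d)
    (wstar_min : forall w, primal lambda phi x wstar <= primal lambda phi x w)
    (alpha0 : 'cV[R]_n)
    (disp : measure_display) (Omega : measurableType disp)
    (Pr : probability Omega R) (I : nat -> Omega -> 'I_n) :
  let Ltmax := maxI hn Lt in
  let L := maxI hn Li in
  let Q := n%:R^-1 * \sum_(i < n) enorm (x i) ^+ 2 in
  let alphastar := \col_(i < n) - derive1 (phi i) (dot (x i) wstar) in
  let gamma := lambda * Ltmax in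
  let prob := adf_prob lambda gamma x in
  let step := adf_step lambda gamma x in
  let state t omega :=
    sdca_run lambda phi x prob step alpha0 (fun r => I r omega) t in
  let alpha t omega := (state t omega).1 in
  let w t omega := (state t omega).2 in
  let kappa t omega := residue phi x (state t omega) in
  let theta t omega := step (kappa t omega) in
  let D t omega := potential gamma alphastar wstar (state t omega) in
  let C0 := potential gamma alphastar wstar (init_state lambda x alpha0) in
  let thetastar := adf_rate lambda gamma x in
  (forall i, smooth1 Ltmax (phi i)) ->
  (forall i, convex_function [set: R^o] (phi i)) ->
  sdca_sampling lambda phi x prob step alpha0 Pr I ->
  (forall t, {ae Pr, forall omega,
     kappa t omega != 0 -> 0 < theta t omega < 1}) ->
  [/\ forall t, {ae Pr, forall omega,
        (cond_expectation Pr (D t.+1) (alpha t) omega <=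
         ((1 - thetastar) * D t omega)%:E)%E},
      forall t omega, kappa t omega != 0 -> thetastar <= theta t omega
    & forall (eps : R) (T : nat), 0 < eps ->
        ((n%:R + Ltmax * Q / lambda)%:E *
           lne (((lambda + L) * C0 / (2 * lambda * Ltmax * eps))%:E)
         <= T%:R%:E)%E ->
        ('E_Pr[fun omega =>
           (primal lambda phi x (w T omega) - primal lambda phi x wstar)%R]
         <= eps%:E)%E].
Proof.
move=> Ltmax L Q alphastar gamma prob step state alpha w kappa theta D C0 thetastar.
move=> sm cv sampling _.
have M_gt0 : 0 < Ltmax := lt_le_trans (Lt_gt0 (Ordinal hn)) (maxI_ge hn Lt (Ordinal hn)).
have g_ge0 : 0 <= gamma by rewrite mulr_ge0 ?ltW.
have LiL i : Li i <= L := maxI_ge hn Li i.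
have stat : primal_grad lambda phi x wstar = 0 :=
  primal_stationary hn phi_derivable Li_smooth LiL wstar_min.
split.
- move=> t; apply: aeW => omega.
  exact: (cond_expected_potential hn hlambda M_gt0 phi_derivable sm cv stat sampling).
- by move=> t omega; exact: adf_rate_le_step.
move=> eps T eps0 hT.
have subopt (L' : R) (LiL' : forall i, Li i <= L') (lL' : 0 <= lambda + L') :=
  expected_suboptimality hn hlambda M_gt0 phi_derivable sm cv stat sampling
    T Li_smooth LiL' lL'.
(* If [d = 0] the constants [Li] may be negative. *)
have [lL|lL] := leP 0 (lambda + L); last first.
  (* With -lambda as the common bound, the factor lambda + L becomes 0 and so does the bound on the
     gap. *)
  have LiN i : Li i <= - lambda by apply: (le_trans (LiL i)); lra.
  apply: (le_trans (subopt _ LiN _)); first by rewrite subrr.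
  by rewrite subrr !mul0r lee_fin ltW.
apply: (le_trans (subopt _ LiL lL)); rewrite lee_fin.
have rE : thetastar = (n%:R + Ltmax * Q / lambda)^-1 := adf_rateE x hn hlambda (ltW M_gt0).
have a_gt0 : 0 < n%:R + Ltmax * Q / lambda.
  rewrite ltr_pwDl ?ltr0n // divr_ge0 ?(ltW hlambda) // mulr_ge0 ?(ltW M_gt0) //.
  by rewrite mulr_ge0 ?invr_ge0 // sumr_ge0 // => i _; rewrite sqr_ge0.
have r01 : 0 < thetastar <= 1 by rewrite adf_rate_le1 // rE invr_gt0 a_gt0.
have := one_sub_expn_le r01; rewrite rE invrK => /(_ _ _ hT); rewrite -rE.
(* The argument of the logarithm, times [eps], is the prefactor (lambda + L) / (2 gamma) times
   [C0]. *)
rewrite -(ler_pM2l eps0) mulr1; apply: le_trans.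
rewrite le_eqVlt; apply/orP; left; apply/eqP; rewrite -/gamma -/alphastar -/thetastar -/C0.
by rewrite /gamma; field; rewrite !gt_eqF.
Qed.
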